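(* Let $(\mathscr{K},\otimes,1)$ be a tensor triangulated category. Non-empty irreducible closed subsets of $\operatorname{Spc}(\mathscr{K})$ have a unique generic point. Indeed, for $\varnothing\neq Z\subset\operatorname{Spc}(\mathscr{K})$ closed, the following are equivalent: (i) $Z$ is irreducible. (ii) For all $a,b\in\mathscr{K}$, if $U(a\oplus b)\cap Z=\varnothing$ then $U(a)\cap Z=\varnothing$ or $U(b)\cap Z=\varnothing$. (iii) $\mathscr{P}:=\{a\in\mathscr{K}\mid U(a)\cap Z\neq\varnothing\}$ is a prime. Moreover, when these conditions hold, $Z=\overline{\{\mathscr{P}\}}$.
   Context: All categories are essentially small. A tensor triangulated category $(\mathscr{K},\otimes,1)$ is a triangulated category $\mathscr{K}$ (translation functor $T$) with a symmetric monoidal product $\otimes:\mathscr{K}\times\mathscr{K}\to\mathscr{K}$ which is exact in each variable, with unit $1$. A thick $\otimes$-ideal of $\mathscr{K}$ is a full subcategory $\mathscr{A}$ containing $0$ such that: (a) for any distinguished triangle $a\to b\to c\to Ta$, if two of $a,b,c$ belong to $\mathscr{A}$ then so does the third; (b) if $a\in\mathscr{A}$ and $a\simeq b\oplus c$ in $\mathscr{K}$ then $b,c\in\mathscr{A}$; (c) if $a\in\mathscr{A}$ and $b\in\mathscr{K}$ then $a\otimes b\in\mathscr{A}$. A prime of $\mathscr{K}$ is a thick $\otimes$-ideal $\mathscr{P}\subsetneq\mathscr{K}$ such that $a\otimes b\in\mathscr{P}$ implies $a\in\mathscr{P}$ or $b\in\mathscr{P}$. $\operatorname{Spc}(\mathscr{K})$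 is the set of all primes of $\mathscr{K}$, with the Zariski topology, whose closed subsets are the sets $Z(\mathscr{S})=\{\mathscr{P}\in\operatorname{Spc}(\mathscr{K})\mid\mathscr{S}\cap\mathscr{P}=\varnothing\}$ for collections of objects $\mathscr{S}\subset\mathscr{K}$. For an object $a$, $U(a)=\{\mathscr{P}\in\operatorname{Spc}(\mathscr{K})\mid a\in\mathscr{P}\}$, an open subset. A generic point of $Z$ is a point of $Z$ whose closure is $Z$. *)

(* Defs.v *)
From HB Require Import structures.
From mathcomp Require Import all_boot all_algebra.
From mathcomp Require Import all_classical topology_structure.
Set Implicit Arguments.
Unset Strict Implicit.
Unset Printing Implicit Defensive.
Import GRing.Theory.
Local Open Scope classical_set_scope.
Local Open Scope ring_scope.

(* The objects form a type, so every category here is small; no further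
   smallness condition is imposed. *)
Record preadditive := Preadditive {
  obj :> Type;
  hom : obj -> obj -> zmodType;
  idm : forall a, hom a a;
  compm : forall a b c, hom b c -> hom a b -> hom a c;
  comp1m : forall a b (f : hom a b), compm (idm b) f = f;
  compm1 : forall a b (f : hom a b), compm f (idm a) = f;
  compA : forall a b c d (h : hom c d) (g : hom b c) (f : hom a b),
    compm h (compm g f) = compm (compm h g) f;
  compDl : forall a b c (g g' : hom b c) (f : hom a b),
    compm (g + g') f = compm g f + compm g' f;
  compDr : forall a b c (g : hom b c) (f f' : hom a b),
    compm g (f + f') = compm g f + compm g f' }.

Arguments hom {p} a b : rename.
Arguments idm {p} a : rename.
Arguments compm {p a b c} g f : rename.

Notation "g ∘ f" := (compm g f) (at level 40, left associativity).

Definition is_iso (C : preadditive) (a b : C) (f : hom a b) : Prop :=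
  exists g : hom b a, g ∘ f = idm a /\ f ∘ g = idm b.

Definition isomorphic (C : preadditive) (a b : C) : Prop :=
  exists f : hom a b, is_iso f.

Record additive := Additive {
  additive_base :> preadditive;
  zobj : additive_base;
  zobj_terminal : forall a (f : hom a zobj), f = 0;
  zobj_initial : forall a (f : hom zobj a), f = 0;
  biprod : additive_base -> additive_base -> additive_base;
  bin1 : forall a b, hom a (biprod a b);
  bin2 : forall a b, hom b (biprod a b);
  bpr1 : forall a b, hom (biprod a b) a;
  bpr2 : forall a b, hom (biprod a b) b;
  bpr1_in1 : forall a b, bpr1 a b ∘ bin1 a b = idm a;
  bpr1_in2 : forall a b, bpr1 a b ∘ bin2 a b = 0;
  bpr2_in1 : forall a b, bpr2 a b ∘ bin1 a b = 0;
  bpr2_in2 : forall a b, bpr2 a b ∘ bin2 a b = idm b;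
  bin_pr : forall a b,
    bin1 a b ∘ bpr1 a b + bin2 a b ∘ bpr2 a b = idm (biprod a b) }.

Arguments biprod {a} _ _ : rename.

Notation "a ⊕ b" := (biprod a b) (at level 50, left associativity).

Record functor (C D : preadditive) := Functor {
  fobj :> C -> D;
  fmap : forall a b, hom a b -> hom (fobj a) (fobj b);
  fmap1 : forall a, fmap (idm a) = idm (fobj a);
  fmapM : forall a b c (g : hom b c) (f : hom a b),
    fmap (g ∘ f) = fmap g ∘ fmap f }.

Arguments fmap {C D} F {a b} f : rename.

Definition additive_functor (C D : preadditive) (F : functor C D) : Prop :=
  forall (a b : C) (f g : hom a b), fmap F (f + g) = fmap F f + fmap F g.

(* Quasi-inverse G, with unit and counit natural isomorphisms. *)
Definition equivalence (C D : preadditive) (F : functor C D) : Prop :=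
  exists (G : functor D C)
    (eta : forall a : C, hom a (G (F a)))
    (eps : forall b : D, hom (F (G b)) b),
    [/\ forall a, is_iso (eta a),
        forall a a' (f : hom a a'), eta a' ∘ f = fmap G (fmap F f) ∘ eta a,
        forall b, is_iso (eps b)
      & forall b b' (f : hom b b'), eps b' ∘ fmap F (fmap G f) = f ∘ eps b].

(* [dist f g h] means that a --f--> b --g--> c --h--> T a is distinguished. *)
Record triangulated := Triangulated {
  triangulated_base :> additive;
  tr : functor triangulated_base triangulated_base;
  tr_additive : additive_functor tr;
  tr_equivalence : equivalence tr;
  dist : forall a b c : triangulated_base,
    hom a b -> hom b c -> hom c (tr a) -> Prop;
  (* TR1 *)
  dist_iso : forall a b c a' b' c'
    (f : hom a b) (g : hom b c) (h : hom c (tr a))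
    (f' : hom a' b') (g' : hom b' c') (h' : hom c' (tr a'))
    (u : hom a a') (v : hom b b') (w : hom c c'),
    is_iso u -> is_iso v -> is_iso w ->
    v ∘ f = f' ∘ u -> w ∘ g = g' ∘ v -> fmap tr u ∘ h = h' ∘ w ->
    dist f g h -> dist f' g' h';
  dist_id : forall a,
    dist (idm a) (0 : hom a (zobj triangulated_base)) 0;
  dist_cone : forall a b (f : hom a b),
    exists c (g : hom b c) (h : hom c (tr a)), dist f g h;
  (* TR2 *)
  dist_rotate : forall a b c (f : hom a b) (g : hom b c) (h : hom c (tr a)),
    dist f g h <-> dist g h (- fmap tr f);
  (* TR3 *)
  dist_morphism : forall a b c a' b' c'
    (f : hom a b) (g : hom b c) (h : hom c (tr a))
    (f' : hom a' b') (g' : hom b' c') (h' : hom c' (tr a'))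
    (u : hom a a') (v : hom b b'),
    dist f g h -> dist f' g' h' -> v ∘ f = f' ∘ u ->
    exists w : hom c c', w ∘ g = g' ∘ v /\ fmap tr u ∘ h = h' ∘ w;
  (* TR4, the octahedral axiom, for the composite of f and g *)
  dist_octahedron : forall a b c x y z (f : hom a b) (g : hom b c)
    (f1 : hom b x) (f2 : hom x (tr a))
    (g1 : hom c y) (g2 : hom y (tr b))
    (h1 : hom c z) (h2 : hom z (tr a)),
    dist f f1 f2 -> dist g g1 g2 -> dist (g ∘ f) h1 h2 ->
    exists (u : hom x z) (v : hom z y),
      [/\ dist u v (fmap tr f1 ∘ g2),
          u ∘ f1 = h1 ∘ g, h2 ∘ u = f2,
          v ∘ h1 = g1 & g2 ∘ v = fmap tr f ∘ h2] }.

Arguments tr {t} : rename.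
Arguments dist {t a b c} f g h : rename.

Definition exact_functor (C D : triangulated) (F : functor C D) : Prop :=
  additive_functor F /\
  exists xi : forall a : C, hom (F (tr a)) (tr (F a)),
    [/\ forall a, is_iso (xi a),
        forall a b (f : hom a b),
          xi b ∘ fmap F (fmap tr f) = fmap tr (fmap F f) ∘ xi a
      & forall a b c (f : hom a b) (g : hom b c) (h : hom c (tr a)),
          dist f g h -> dist (fmap F f) (fmap F g) (xi a ∘ fmap F h)].

Record symmetric_monoidal (C : preadditive) := SymmetricMonoidal {
  tens : C -> C -> C;
  tensm : forall a a' b b', hom a a' -> hom b b' -> hom (tens a b) (tens a' b');
  tensm1 : forall a b, tensm (idm a) (idm b) = idm (tens a b);
  tensmM : forall a a' a'' b b' b''
    (f' : hom a' a'') (f : hom a a') (g' : hom b' b'') (g : hom b b'),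
    tensm (f' ∘ f) (g' ∘ g) = tensm f' g' ∘ tensm f g;
  tunit : C;
  tassoc : forall a b c, hom (tens (tens a b) c) (tens a (tens b c));
  tassoc_iso : forall a b c, is_iso (tassoc a b c);
  tassoc_nat : forall a a' b b' c c'
    (f : hom a a') (g : hom b b') (h : hom c c'),
    tassoc a' b' c' ∘ tensm (tensm f g) h =
    tensm f (tensm g h) ∘ tassoc a b c;
  tlunit : forall a, hom (tens tunit a) a;
  tlunit_iso : forall a, is_iso (tlunit a);
  tlunit_nat : forall a a' (f : hom a a'),
    tlunit a' ∘ tensm (idm tunit) f = f ∘ tlunit a;
  trunit : forall a, hom (tens a tunit) a;
  trunit_iso : forall a, is_iso (trunit a);
  trunit_nat : forall a a' (f : hom a a'),
    trunit a' ∘ tensm f (idm tunit) = f ∘ trunit a;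
  tbraid : forall a b, hom (tens a b) (tens b a);
  tbraid_nat : forall a a' b b' (f : hom a a') (g : hom b b'),
    tbraid a' b' ∘ tensm f g = tensm g f ∘ tbraid a b;
  tbraidK : forall a b, tbraid b a ∘ tbraid a b = idm (tens a b);
  tens_pentagon : forall a b c d,
    tassoc a b (tens c d) ∘ tassoc (tens a b) c d =
    tensm (idm a) (tassoc b c d) ∘ tassoc a (tens b c) d
      ∘ tensm (tassoc a b c) (idm d);
  tens_triangle : forall a b,
    tensm (idm a) (tlunit b) ∘ tassoc a tunit b = tensm (trunit a) (idm b);
  tens_hexagon : forall a b c,
    tassoc b c a ∘ tbraid a (tens b c) ∘ tassoc a b c =
    tensm (idm b) (tbraid a c) ∘ tassoc b a c ∘ tensm (tbraid a b) (idm c) }.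

Lemma tens_left_fmapM (C : preadditive) (M : symmetric_monoidal C)
    (x a b c : C) (g : hom b c) (f : hom a b) :
  tensm M (idm x) (g ∘ f) = tensm M (idm x) g ∘ tensm M (idm x) f.
Proof. by rewrite -tensmM comp1m. Qed.

Lemma tens_right_fmapM (C : preadditive) (M : symmetric_monoidal C)
    (x a b c : C) (g : hom b c) (f : hom a b) :
  tensm M (g ∘ f) (idm x) = tensm M g (idm x) ∘ tensm M f (idm x).
Proof. by rewrite -tensmM comp1m. Qed.

Definition tens_left (C : preadditive) (M : symmetric_monoidal C) (x : C) :
    functor C C :=
  @Functor C C (tens M x) (fun a b f => tensm M (idm x) f)
    (tensm1 M x) (@tens_left_fmapM C M x).

Definition tens_right (C : preadditive) (M : symmetric_monoidal C) (x : C) :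
    functor C C :=
  @Functor C C (fun a => tens M a x) (fun a b f => tensm M f (idm x))
    (fun a => tensm1 M a x) (@tens_right_fmapM C M x).

(* Exactness is required in each variable separately, with no compatibility
   between the two suspension isomorphisms. *)
Record ttcategory := TTCategory {
  tt_triangulated :> triangulated;
  tt_monoidal : symmetric_monoidal tt_triangulated;
  tt_exact_left : forall x, exact_functor (tens_left tt_monoidal x);
  tt_exact_right : forall x, exact_functor (tens_right tt_monoidal x) }.

Notation "a ⊗ b" := (tens (tt_monoidal _) a b)
  (at level 40, left associativity).

(* Full subcategories are given by their sets of objects.  Replete: closure under
   isomorphism is [thick_summand] applied to [a ⊕ 0], cf. [thick_iso] below. *)
Record thick_tens_ideal (K : ttcategory) (A : set K) : Prop := ThickTensIdeal {
  thick0 : A (zobj K);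
  thick_dist : forall (a b c : K) (f : hom a b) (g : hom b c) (h : hom c (tr a)),
    dist f g h ->
    [/\ A a -> A b -> A c, A a -> A c -> A b & A b -> A c -> A a];
  thick_summand : forall a b c : K, A a -> isomorphic a (b ⊕ c) -> A b /\ A c;
  thick_tens : forall a b : K, A a -> A (a ⊗ b) }.

Record tt_prime (K : ttcategory) (P : set K) : Prop := TTPrime {
  prime_ideal : thick_tens_ideal P;
  prime_proper : P <> setT;
  prime_tens : forall a b : K, P (a ⊗ b) -> P a \/ P b }.

Record Spc (K : ttcategory) : Type := SpcPoint {
  spc_set : set K;
  spc_prime : tt_prime spc_set }.

(* Z(S) of the Zariski topology: the primes that do not meet S. *)
Definition spcZ (K : ttcategory) (S : set K) : set (Spc K) :=
  [set P : Spc K | S `&` spc_set P = set0].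

Definition spcU (K : ttcategory) (a : K) : set (Spc K) :=
  [set P : Spc K | spc_set P a].

Definition zariski_open (K : ttcategory) : set_system (Spc K) :=
  [set W | exists S : set K, ~` W = spcZ S].

Section Zariski.
Variable K : ttcategory.
Implicit Types (a b c : K) (P : Spc K) (S : set K).

Lemma comp0m (C : preadditive) (x y z : C) (f : hom x y) :
  (0 : hom y z) ∘ f = 0.
Proof. by apply: (addrI (0 ∘ f)); rewrite -compDl !addr0. Qed.

Lemma compm0 (C : preadditive) (x y z : C) (g : hom y z) :
  g ∘ (0 : hom x y) = 0.
Proof. by apply: (addrI (g ∘ 0)); rewrite -compDr !addr0. Qed.

Lemma compNm (C : preadditive) (x y z : C) (g : hom y z) (f : hom x y) :
  (- g) ∘ f = - (g ∘ f).
Proof. by apply/eqP; rewrite -addr_eq0 -compDl addNr comp0m. Qed.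

Lemma tr0 (x y : K) : fmap tr (0 : hom x y) = 0.
Proof.
by apply: (addrI (fmap tr 0)); rewrite -tr_additive !addr0.
Qed.

Lemma is_iso_idm (C : preadditive) (x : C) : is_iso (idm x).
Proof. by exists (idm x); rewrite comp1m. Qed.

Lemma dist_0id (x : K) :
  dist (0 : hom (zobj K) x) (idm x) (0 : hom x (tr (zobj K))).
Proof.
apply/dist_rotate; rewrite tr0 oppr0.
have z : is_iso (0 : hom (zobj K) (tr (zobj K))).
  exists 0; split; first by rewrite [RHS]zobj_initial compm0.
  by rewrite -fmap1 (zobj_initial (idm (zobj K))) tr0 comp0m.
apply: (dist_iso (is_iso_idm x) (is_iso_idm x) z _ _ _ (dist_id x)).
- by [].
- by rewrite !comp0m.
- by rewrite !compm0.
Qed.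

Lemma dist_weak_cokernel (a b c x : K) (f : hom a b) (g : hom b c)
    (h : hom c (tr a)) (p : hom b x) :
  dist f g h -> p ∘ f = 0 -> exists q : hom c x, p = q ∘ g.
Proof.
move=> fgh pf0.
have [|w [wg _]] := @dist_morphism K a b c _ _ _ f g h _ _ _ 0 p fgh (dist_0id x).
  by rewrite comp0m.
by exists w; rewrite wg comp1m.
Qed.

Lemma dist_biprod (a b : K) : exists c (g : hom (a ⊕ b) c) (h : hom c (tr a)),
  dist (bin1 a b) g h /\ isomorphic b c.
Proof.
have [c [g [h fgh]]] := dist_cone (bin1 a b).
exists c, g, h; split => //.
have gf0 : g ∘ bin1 a b = 0.
  have [//|w [<- _]] := @dist_morphism K _ _ _ _ _ _ _ _ _ _ _ _ (idm a)
    (bin1 a b) (dist_id a) fgh.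
  by rewrite compm0.
have h0 : h = 0.
  have ghf := (dist_rotate _ _ _).1 ((dist_rotate _ _ _).1 fgh).
  have [//|w [w0 _]] := @dist_morphism K _ _ _ _ _ _ _ _ _ _ _ _ (idm c) h
    (dist_id c) ghf.
  move: w0; rewrite compm0 compNm => /esym/eqP; rewrite oppr_eq0 => /eqP fh0.
  by rewrite -(comp1m h) -fmap1 -(bpr1_in1 a b) fmapM -compA fh0 compm0.
have [v gv] := dist_weak_cokernel fgh (bpr2_in1 a b).
exists (g ∘ bin2 a b), v; split; first by rewrite compA -gv bpr2_in2.
have [|k uv] := @dist_weak_cokernel _ _ _ c g h _ (g ∘ bin2 a b ∘ v - idm c)
  ((dist_rotate _ _ _).1 fgh).
  apply/eqP; rewrite compDl compNm comp1m subr_eq0; apply/eqP.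
  rewrite -compA -gv -compA -[RHS]compm1 -bin_pr compDr.
  by rewrite [g ∘ (bin1 a b ∘ _)]compA gf0 comp0m add0r.
by apply/eqP; rewrite -subr_eq0 uv h0 compm0.
Qed.

Lemma thick_iso (A : set K) : thick_tens_ideal A ->
  forall a b, isomorphic a b -> A a -> A b.
Proof.
move=> tA a b [f [g [gf fg]]] Aa.
suff : isomorphic a (b ⊕ zobj K) by move/(thick_summand tA Aa) => [].
exists (bin1 b (zobj K) ∘ f), (g ∘ bpr1 b (zobj K)); split.
  by rewrite -compA [X in g ∘ X]compA bpr1_in1 comp1m.
rewrite -compA [X in _ ∘ X]compA fg comp1m -[RHS]bin_pr.
by rewrite (zobj_initial (bin2 _ _)) comp0m addr0.
Qed.

Lemma spc_biprodE P a b :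
  spc_set P (a ⊕ b) <-> spc_set P a /\ spc_set P b.
Proof.
have tP := prime_ideal (spc_prime P); split => [Pab|[Pa Pb]].
  apply: (thick_summand tP Pab).
  by exists (idm (a ⊕ b)); exact: is_iso_idm.
have [c [g [h [fgh bc]]]] := dist_biprod a b.
have [_ Pac _] := thick_dist tP fgh.
by apply: Pac => //; exact: thick_iso bc Pb.
Qed.

Lemma zariski_openT : zariski_open (setT : set (Spc K)).
Proof.
exists setT; rewrite setCT; apply/esym; rewrite -subset0 => P.
rewrite /spcZ /= setTI => P0.
by have := thick0 (prime_ideal (spc_prime P)); rewrite P0.
Qed.

Lemma zariski_openI : setI_closed (@zariski_open K).
Proof.
move=> W W' [S WS] [S' WS'].
exists [set a ⊕ b | a in S & b in S'].
rewrite setCI WS WS' predeqE => P; split.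
  move=> SP; rewrite /spcZ /= -subset0 => _ [[a Sa [b Sb <-]]].
  case/spc_biprodE => Pa Pb; case: SP; rewrite /spcZ /= -subset0.
    by move/(_ a); apply.
  by move/(_ b); apply.
rewrite /spcZ /= => SSP; apply: contrapT => /not_orP[].
move=> /eqP/set0P[a [Sa Pa]] /eqP/set0P[b [Sb Pb]].
have : (set0 : set K) (a ⊕ b); last by [].
rewrite -SSP; split; first by exists a => //; exists b.
exact/spc_biprodE.
Qed.

Lemma zariski_open_bigU (J : Type) (f : J -> set (Spc K)) :
  (forall i, zariski_open (f i)) -> zariski_open (\bigcup_i f i).
Proof.
move=> fo; have [S fS] := choice fo.
exists (\bigcup_i S i); rewrite setC_bigcup predeqE => P; split.
  move=> fP; rewrite /spcZ /= -subset0 => a [[i _ Sa] Pa].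
  by have := fP i I; rewrite fS /spcZ /= -subset0 => /(_ a); apply.
rewrite /spcZ /= => SP i _; rewrite fS /spcZ /= -subset0 => a [Sa Pa].
by move: SP; rewrite -subset0 => /(_ a); apply; split => //; exists i.
Qed.

HB.instance Definition _ := gen_eqMixin (Spc K).
HB.instance Definition _ := gen_choiceMixin (Spc K).
HB.instance Definition _ := isOpenTopological.Build (Spc K)
  zariski_openT zariski_openI zariski_open_bigU.

Lemma zariski_closedE (Z : set (Spc K)) :
  closed Z <-> exists S : set K, Z = spcZ S.
Proof.
rewrite -openC /open /= /zariski_open /=.
by split=> -[S ZS]; exists S; rewrite -ZS setCK.
Qed.

End Zariski.

(* Stated with closed subsets of T: the closed subsets of the subspace A are the
   [A `&` C] with C closed in T.  The empty set is not excluded. *)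
Definition irreducible_set (T : topologicalType) (A : set T) : Prop :=
  forall C D : set T, closed C -> closed D ->
    A `<=` C `|` D -> A `<=` C \/ A `<=` D.

Definition generic_point (T : topologicalType) (Z : set T) (x : T) : Prop :=
  Z x /\ closure [set x] = Z.

(* The set of objects that is the candidate generic point of Z. *)
Definition meeting_objects (K : ttcategory) (Z : set (Spc K)) : set K :=
  [set a | spcU a `&` Z !=set0].

(* Main.v *)
Require Import Defs.
From mathcomp Require Import all_boot all_algebra.
From mathcomp Require Import all_classical topology_structure.
Local Open Scope classical_set_scope.

(** The specialization order of the spectrum runs opposite to the one of
    commutative algebra: the closure of a prime [P] consists of the primes
    contained in [P] ([closure_spc1]).  A generic point of [Z] must therefore
    be the largest prime in [Z], and the natural candidate is the union of all
    the primes in [Z], which is [meeting_objects Z].  If this union is a prime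
    at all, then it lies in the closed set [Z], because the objects that the
    points of [Z] avoid are avoided by their union, and it contains every point
    of [Z]; so its closure is [Z] ([closure_meeting_objects]).

    A union of primes inherits every closure property with a single premise:
    direct summands, tensor multiples, and the splitting of a tensor product
    that defines primality.  It is proper because no prime contains the unit.
    Only two-out-of-three has two premises, which may come from different
    primes.  Condition (ii), in contrapositive form and with
    U(a ⊕ b) = U(a) ∩ U(b), says exactly that two objects of the union belong to
    a common prime of [Z] ([meeting_objects_prime]).

    On the topological side, the complements of the U(a) are closed, so an
    irreducible [Z] satisfies (ii); and the closure of a point is irreducible.
    Uniqueness of the generic point holds because the specialization order is
    antisymmetric: a point of the spectrum is determined by its set of
    objects. *)

(** The closure of a point is irreducible: whichever closed set of a covering
    pair contains the point contains its closure. *)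
Lemma irreducible_closure1 (T : topologicalType) (x : T) :
  irreducible_set (closure [set x]).
Proof.
move=> C D cC cD sCD.
have sub E : closed E -> E x -> closure [set x] `<=` E.
  by move=> cE Ex; rewrite closureE; apply: smallest_sub => // _ ->.
have [xC|xD] : (C `|` D) x by apply: sCD; exact: subset_closure.
- by left; exact: sub.
- by right; exact: sub.
Qed.

Lemma spc_inj (K : ttcategory) (P Q : Spc K) :
  spc_set P = spc_set Q -> P = Q.
Proof.
case: P Q => [P pP] [Q pQ] /= PQ; subst Q.
by rewrite (Prop_irrelevance pP pQ).
Qed.

Lemma spcZP (K : ttcategory) (S : set K) (P : Spc K) :
  spcZ S P <-> spc_set P `<=` ~` S.
Proof.
rewrite /spcZ /= -subset0.
by split=> [SP a Pa Sa|PS a [Sa Pa]]; [exact: (SP a)|exact: (PS a)].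
Qed.

Lemma spcU_biprod (K : ttcategory) (a b : K) :
  spcU (a ⊕ b) = spcU a `&` spcU b.
Proof. by apply/seteqP; split=> P /spc_biprodE. Qed.

Lemma closed_spcUC (K : ttcategory) (a : K) : closed (~` spcU a).
Proof.
apply/zariski_closedE; exists [set a]; apply/seteqP; split=> P.
- by move=> Pa; apply/spcZP => b Pb ba; apply: Pa; rewrite -ba.
- by move/spcZP => Pa aP; exact: (Pa a).
Qed.

(** Closed sets are defined by the objects that their points avoid, and a
    smaller prime avoids more; the smallest such set around [P] is cut out by
    the complement of [P]. *)
Lemma closure_spc1 (K : ttcategory) (P : Spc K) :
  closure [set P] = [set Q : Spc K | spc_set Q `<=` spc_set P].
Proof.
rewrite closureE; apply/seteqP; split=> [Q|Q QP].
  have cP : closed (spcZ (~` spc_set P)) by apply/zariski_closedE; eexists.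
  move=> /(_ (spcZ (~` spc_set P))) QP.
  suff : spcZ (~` spc_set P) Q by move/spcZP; rewrite setCK.
  by apply: QP; split=> // _ ->; apply/spcZP; rewrite setCK.
move=> C [/zariski_closedE[S ->] PS].
by apply/spcZP; apply: subset_trans QP _; apply/spcZP; exact: PS.
Qed.

Lemma generic_point_unique (K : ttcategory) (Z : set (Spc K)) (P Q : Spc K) :
  generic_point Z P -> generic_point Z Q -> P = Q.
Proof.
move=> [ZP cP] [ZQ cQ]; apply: spc_inj; apply/seteqP; split.
- by move: ZP; rewrite -cQ closure_spc1.
- by move: ZQ; rewrite -cP closure_spc1.
Qed.

(** A prime that contained the unit would contain every [a], as [a] is
    isomorphic to the tensor product of the unit with [a]. *)
Lemma prime_tunit (K : ttcategory) (P : set K) :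
  tt_prime P -> ~ P (tunit (tt_monoidal K)).
Proof.
move=> [tP pP _] P1; apply: pP; apply/seteqP; split=> // a _.
apply: (thick_iso tP (a := tunit (tt_monoidal K) ⊗ a)).
  by exists (tlunit (tt_monoidal K) a); exact: tlunit_iso.
exact: thick_tens.
Qed.

(** Two-out-of-three is where the hypothesis enters: two objects of the union
    may be taken in the same prime of [Z]. *)
Lemma meeting_objects_prime (K : ttcategory) (Z : set (Spc K)) :
  Z !=set0 ->
  (forall a b : K, spcU (a ⊕ b) `&` Z = set0 ->
     spcU a `&` Z = set0 \/ spcU b `&` Z = set0) ->
  tt_prime (meeting_objects Z).
Proof.
move=> [P0 ZP0] ii.
have common a b : meeting_objects Z a -> meeting_objects Z b ->
    exists P : Spc K, [/\ Z P, spc_set P a & spc_set P b].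
  move=> ma mb; have /set0P[P [UP ZP]] : spcU (a ⊕ b) `&` Z != set0.
    by apply/eqP => /ii[] /eqP; apply/negP/set0P.
  by exists P; split=> //; case/spc_biprodE: UP.
have ideal (P : Spc K) := prime_ideal (spc_prime P).
split; first split.
- by exists P0; split => //; exact: thick0 (ideal P0).
- move=> a b c f g h fgh; split=> ma mb.
  + have [P [ZP Pa Pb]] := common _ _ ma mb.
    by exists P; split=> //; case: (thick_dist (ideal P) fgh) => H _ _; exact: H.
  + have [P [ZP Pa Pb]] := common _ _ ma mb.
    by exists P; split=> //; case: (thick_dist (ideal P) fgh) => _ H _; exact: H.
  + have [P [ZP Pa Pb]] := common _ _ ma mb.
    by exists P; split=> //; case: (thick_dist (ideal P) fgh) => _ _ H; exact: H.
- move=> a b c [P [Pa ZP]] abc.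
  have [Pb Pc] := thick_summand (ideal P) Pa abc.
  by split; exists P.
- by move=> a b [P [Pa ZP]]; exists P; split=> //; exact: thick_tens.
- move=> mT; have [P [P1 _]] : meeting_objects Z (tunit (tt_monoidal K)).
    by rewrite mT.
  exact: prime_tunit (spc_prime P) P1.
- move=> a b [P [Pab ZP]].
  by have [Pa|Pb] := prime_tens (spc_prime P) Pab; [left|right]; exists P.
Qed.

(** An object avoided by all the points of [Z] is avoided by their union, so
    the union satisfies the condition that defines the closed set [Z]; and it
    contains each of these points. *)
Lemma closure_meeting_objects (K : ttcategory) (Z : set (Spc K))
    (mZ : tt_prime (meeting_objects Z)) :
  closed Z -> Z = closure [set SpcPoint mZ].
Proof.
move=> /zariski_closedE[S ZS]; rewrite closure_spc1; apply/seteqP; split.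
  by move=> Q ZQ a Qa; exists Q.
move=> Q QZ; rewrite ZS; apply/spcZP => a /QZ[P [Pa]].
by rewrite ZS => /spcZP; exact.
Qed.

Lemma irreducible_spcU_biprod (K : ttcategory) (Z : set (Spc K)) :
  irreducible_set Z ->
  forall a b : K, spcU (a ⊕ b) `&` Z = set0 ->
    spcU a `&` Z = set0 \/ spcU b `&` Z = set0.
Proof.
move=> irrZ a b; rewrite setIC => /disjoints_subset.
rewrite spcU_biprod setCI => /(irrZ _ _ (closed_spcUC _ a) (closed_spcUC _ b)).
by case=> /disjoints_subset; rewrite setIC; [left|right].
Qed.

Theorem proposition2p18 (K : ttcategory) :
  (forall Z : set (Spc K), closed Z -> Z !=set0 -> irreducible_set Z ->
     exists! P : Spc K, generic_point Z P) /\
  (forall Z : set (Spc K), closed Z -> Z !=set0 ->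
     [/\ irreducible_set Z <->
           (forall a b : K, spcU (a ⊕ b) `&` Z = set0 ->
              spcU a `&` Z = set0 \/ spcU b `&` Z = set0),
         (forall a b : K, spcU (a ⊕ b) `&` Z = set0 ->
            spcU a `&` Z = set0 \/ spcU b `&` Z = set0) <->
           tt_prime (meeting_objects Z)
       & forall P_prime : tt_prime (meeting_objects Z),
           Z = closure [set SpcPoint P_prime]]).
Proof.
have prime_irr (Z : set (Spc K)) : closed Z -> tt_prime (meeting_objects Z) ->
    irreducible_set Z.
  move=> cZ mZ; rewrite (closure_meeting_objects _ _ mZ cZ).
  exact: irreducible_closure1.
split=> Z cZ Z0.
  move=> /irreducible_spcU_biprod/(meeting_objects_prime _ _ Z0) mZ.
  have genZ : generic_point Z (SpcPoint mZ).
    have eZ := closure_meeting_objects _ _ mZ cZ; split=> //.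
    have : closure [set SpcPoint mZ] (SpcPoint mZ) by exact: subset_closure.
    by rewrite -eZ.
  by exists (SpcPoint mZ); split=> // Q; exact: generic_point_unique.
split; last by move=> mZ; exact: closure_meeting_objects.
- split; first exact: irreducible_spcU_biprod.
  by move=> /(meeting_objects_prime _ _ Z0); exact: prime_irr.
- split; first exact: meeting_objects_prime.
  by move=> /(prime_irr _ cZ); exact: irreducible_spcU_biprod.
Qed.
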